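(* Let $z>0$, let $P_n(x;z)$ be the monic truncated Hermite polynomials, $h_n=h_n(z)$ their squared norms and $\gamma_n=\gamma_n(z)$ their recurrence coefficients (with $\gamma_0=0$), and let $\vartheta=z\,\partial_z$. Then $$\vartheta\ln(h_{n})=2n+1-2\left(\gamma_{n+1}+\gamma_{n}\right),\qquad n\ge 0,$$ and $$\vartheta\ln(\gamma_{n})=2\left(\gamma_{n-1}-\gamma_{n+1}+1\right),\qquad n\ge 1.$$
   Context: For $z>0$ let $L[p]=\int_{-z}^{z}p(x)e^{-x^{2}}dx$, $p\in\mathbb{R}[x]$. The truncated Hermite polynomials $P_n(x;z)$, $n\ge0$, are the monic polynomials in $x$ with $\deg P_n=n$ and $L[P_kP_n]=h_n(z)\delta_{k,n}$, where $h_n(z)=L[P_n^2]>0$. They satisfy the three-term recurrence $xP_n(x;z)=P_{n+1}(x;z)+\gamma_n(z)P_{n-1}(x;z)$ with $P_{-1}=0$, $P_0=1$, where $\gamma_n(z)=h_n(z)/h_{n-1}(z)$ for $n\ge1$; convention: $\gamma_0=0$. *)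

(* Defs.v *)
From HB Require Import structures.
From mathcomp Require Import all_boot all_order all_algebra.
From mathcomp Require Import all_classical all_reals all_analysis.
Set Implicit Arguments.
Unset Strict Implicit.
Unset Printing Implicit Defensive.
Import Order.TTheory GRing.Theory Num.Theory.
Import numFieldNormedType.Exports.
Local Open Scope classical_set_scope.
Local Open Scope ring_scope.

Definition trunc_L (R : realType) (z : R) (p : {poly R}) : R :=
  \int[@lebesgue_measure R]_(x in `[- z, z]) (p.[x] * expR (- x ^+ 2)).

(* In everything below, P z n stands for P_n(x; z), a polynomial in x. *)

Definition sq_norm (R : realType) (P : R -> nat -> {poly R}) (n : nat) (z : R) : R :=
  trunc_L z (P z n ^+ 2).

(* The three conditions determine P z n uniquely for z > 0; the values of P at
   z <= 0 are unconstrained. *)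
Definition truncated_hermite (R : realType) (P : R -> nat -> {poly R}) : Prop :=
  forall z : R, 0 < z ->
    [/\ forall n, P z n \is monic,
        forall n, size (P z n) = n.+1
      & forall k n, trunc_L z (P z k * P z n) =
                    if k == n then sq_norm P n z else 0].

Definition rec_coef (R : realType) (P : R -> nat -> {poly R}) (n : nat) (z : R) : R :=
  if n is m.+1 then sq_norm P m.+1 z / sq_norm P m z else 0.

Definition theta (R : realType) (f : R -> R) (z : R) : R := z * derive1 f z.

(* Main.v *)
(** Orthogonality kills the terms of [h_n'] that come from the motion of the
    coefficients of [P_n], so [h_n'] is the boundary term
    [(P_n(z)^2 + P_n(-z)^2) exp(-z^2)].  Integrating the derivative of
    [x P_n(x)^2 exp(-x^2)] over [[-z, z]] gives
    [z h_n' = L[P_n^2 + 2 (x P_n') P_n - 2 (x P_n)^2]], which the recurrence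
    turns into [h_n (1 + 2 n - 2 (gamma_(n+1) + gamma_n))].  The second
    identity is the difference of two instances of the first. *)

Require Import Defs.
From HB Require Import structures.
From mathcomp Require Import all_boot all_order all_algebra.
From mathcomp Require Import all_classical all_reals all_analysis.
From mathcomp Require Import ring lra.
Import Order.TTheory GRing.Theory Num.Theory.
Import numFieldNormedType.Exports.
Local Open Scope classical_set_scope.
Local Open Scope ring_scope.

(** * Weighted integrands, linearity and integration by parts *)

Definition gaussian_mul {R : realType} (p : {poly R}) (x : R) : R :=
  p.[x] * expR (- x ^+ 2).

Lemma is_derive_gaussian_mul {R : realType} (p : {poly R}) (x : R) :
  is_derive x 1 (gaussian_mul p)
    (gaussian_mul (p^`() - 2%:R *: ('X * p)) x).
Proof.
rewrite /gaussian_mul.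
have dE : is_derive x 1 (fun t : R => expR (- t ^+ 2))
    (expR (- x ^+ 2) * (- (2 * x))).
  apply: (@is_derive1_comp _ expR (fun t : R => - t ^+ 2)).
  apply: is_deriveN; apply: is_derive_eq.
  rewrite /GRing.scale/=. ring.
apply: (is_derive_eq (is_deriveM (is_derive_poly p x) dE)).
by rewrite !hornerE /GRing.scale/=; ring.
Qed.

Lemma continuous_gaussian_mul {R : realType} (p : {poly R}) :
  continuous (gaussian_mul p).
Proof.
move=> x; apply/differentiable_continuous/derivable1_diffP.
exact: (@ex_derive _ _ _ _ _ _ _ (is_derive_gaussian_mul p x)).
Qed.

Lemma integrable_segment {R : realType} (f : R -> R) (a b : R) :
  continuous f ->
  (@lebesgue_measure R).-integrable `[a, b] (EFin \o f).
Proof.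
move=> cf; apply: continuous_compact_integrable; first exact: segment_compact.
exact: continuous_subspaceT.
Qed.

Lemma trunc_LD {R : realType} (z : R) (p q : {poly R}) :
  trunc_L z (p + q) = trunc_L z p + trunc_L z q.
Proof.
rewrite /trunc_L -RintegralD//; first last.
- by apply: integrable_segment; exact: (continuous_gaussian_mul q).
- by apply: integrable_segment; exact: (continuous_gaussian_mul p).
by apply: eq_Rintegral => x _; rewrite hornerD mulrDl.
Qed.

Lemma trunc_LZ {R : realType} (z a : R) (p : {poly R}) :
  trunc_L z (a *: p) = a * trunc_L z p.
Proof.
rewrite /trunc_L -RintegralZl//; last first.
  by apply: integrable_segment; exact: (continuous_gaussian_mul p).
by apply: eq_Rintegral => x _; rewrite hornerZ mulrA.
Qed.

(** The integrand is the derivative of [gaussian_mul q], so only boundary values remain; the weight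
    is even, hence equal at both ends. *)
Lemma trunc_L_ibp {R : realType} (z : R) (q : {poly R}) : 0 < z ->
  trunc_L z (q^`() - 2%:R *: ('X * q)) =
  (q.[z] - q.[- z]) * expR (- z ^+ 2).
Proof.
move=> z0; rewrite /trunc_L /Rintegral.
rewrite (@continuous_FTC2 _ _ (gaussian_mul q)) /gaussian_mul.
- by rewrite -EFinD/= sqrrN mulrBl.
- by lra.
- exact/continuous_subspaceT/(continuous_gaussian_mul (_ - _)).
- split=> [x _||].
  + exact: (@ex_derive _ _ _ _ _ _ _ (is_derive_gaussian_mul q x)).
  + by apply: cvg_at_right_filter; exact: (continuous_gaussian_mul q).
  + by apply: cvg_at_left_filter; exact: (continuous_gaussian_mul q).
- move=> x _; rewrite derive1E.
  exact: (@derive_val _ _ _ _ _ _ _ (is_derive_gaussian_mul q x)).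
Qed.

(** * Reflection symmetry and dependence on the endpoint *)

Lemma continuous_gaussian_mul_sym {R : realType} (p : {poly R}) :
  continuous (fun x => gaussian_mul p x + gaussian_mul p (- x)).
Proof.
move=> x; apply: cvgD; first exact: continuous_gaussian_mul.
by apply: continuous_comp; [exact: opp_continuous |
  exact: continuous_gaussian_mul].
Qed.

(** Folding at the origin leaves a single moving endpoint, so that the fundamental theorem of
    calculus applies in [z], and makes the symmetry under reflection visible. *)
Lemma trunc_L_half {R : realType} (z : R) (p : {poly R}) : 0 <= z ->
  trunc_L z p =
  \int[@lebesgue_measure R]_(x in `[0, z])
    (gaussian_mul p x + gaussian_mul p (- x)).
Proof.
move=> z0; have cp := continuous_gaussian_mul p.
have cN : continuous (gaussian_mul p \o -%R).
  by move=> x; apply: continuous_comp; [exact: opp_continuous | exact: cp].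
rewrite RintegralD//; [| exact: integrable_segment ..].
have -> : \int[@lebesgue_measure R]_(x in `[0, z]) gaussian_mul p (- x) =
    \int[@lebesgue_measure R]_(x in `[- z, 0]) gaussian_mul p x.
  have := @integration_by_substitution_oppr _ (gaussian_mul p) _ _ z0.
  by rewrite oppr0 /Rintegral => ->//; exact: continuous_subspaceT.
have iz : (@lebesgue_measure R).-integrable `[- z, z]
  (EFin \o gaussian_mul p) by exact: integrable_segment.
have := @Rintegral_itvB _ _ _ _ 0 iz; rewrite !bnd_simp => /(_ _ _)/esym.
rewrite Rintegral_itv_obnd_cbnd; last first.
  apply: integrableS iz => //; apply: subset_itvr; rewrite bnd_simp; lra.
by move=> ->; [rewrite subrK | lra | lra].
Qed.

Lemma trunc_L_reflect {R : realType} (z : R) (p : {poly R}) : 0 <= z ->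
  trunc_L z (p \Po - 'X) = trunc_L z p.
Proof.
move=> z0; rewrite !trunc_L_half//; apply: eq_Rintegral => x _.
by rewrite /gaussian_mul !horner_comp !hornerE opprK sqrrN addrC.
Qed.

Lemma is_derive_trunc_L {R : realType} (z : R) (p : {poly R}) : 0 < z ->
  is_derive z 1 (fun t => trunc_L t p)
    (gaussian_mul p z + gaussian_mul p (- z)).
Proof.
move=> z0; pose g x := gaussian_mul p x + gaussian_mul p (- x).
have cg : continuous g := continuous_gaussian_mul_sym p.
pose F t := \int[@lebesgue_measure R]_(x in `[0, t]) g x.
apply: (@near_eq_is_derive _ _ _ F).
  near=> t; rewrite trunc_L_half//; near: t.
  by apply: filterS (lt_nbhsr z0) => t /ltW.
(* Any fixed bound beyond [z] would do: the upper limit must be able to move on both sides of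
   [z]. *)
have ig : (@lebesgue_measure R).-integrable `[0, z + 1] (EFin \o g).
  exact: integrable_segment.
have z1 : z < z + 1 by lra.
have [dF F'] := continuous_FTC1_closed z1 ig z0 (cg z).
by apply: DeriveDef => //; rewrite -derive1E F'.
Unshelve. all: by end_near. Qed.

(** * Monotonicity and positivity of the functional *)

Lemma trunc_L_ge0 {R : realType} (z : R) (p : {poly R}) :
  (forall x, 0 <= p.[x]) -> 0 <= trunc_L z p.
Proof.
by move=> p0; apply: Rintegral_ge0 => x _; rewrite mulr_ge0// expR_ge0.
Qed.

Lemma le_trunc_L {R : realType} (t z : R) (p : {poly R}) :
  (forall x, 0 <= p.[x]) -> 0 <= t <= z -> trunc_L t p <= trunc_L z p.
Proof.
move=> p0 /andP[t0 tz]; rewrite !trunc_L_half ?(le_trans t0)//.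
rewrite -subr_ge0 Rintegral_itvB ?bnd_simp//; last first.
  exact/integrable_segment/continuous_gaussian_mul_sym.
by apply: Rintegral_ge0 => x _; rewrite addr_ge0 ?mulr_ge0 ?expR_ge0.
Qed.

(** If the value at [z] were 0, monotonicity would make the functional of [p ^+ 2] vanish on all of
    []0, z[]. So would its derivative, a sum of two nonnegative boundary terms, and every point of
    []0, z[] would be a root of [p]. *)
Lemma trunc_L_sqr_gt0 {R : realType} (z : R) (p : {poly R}) : 0 < z ->
  p != 0 -> 0 < trunc_L z (p ^+ 2).
Proof.
move=> z0 p0.
have p2 x : 0 <= (p ^+ 2).[x] by rewrite horner_exp sqr_ge0.
rewrite lt_def trunc_L_ge0// andbT; apply: contraNneq p0 => Lz.
have L0 t : 0 < t < z -> trunc_L t (p ^+ 2) = 0.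
  move=> /andP[t0 tz]; apply/eqP; rewrite eq_le trunc_L_ge0// andbT -Lz.
  by rewrite le_trunc_L// !ltW.
have pr t : 0 < t < z -> root p t.
  move=> /andP[t0 tz].
  have d0 : is_derive t 1 (fun s => trunc_L s (p ^+ 2)) 0.
    apply: (@near_eq_is_derive _ _ _ (cst 0)).
    near=> s; rewrite L0//; apply/andP; split; near: s.
      exact: lt_nbhsr.
    exact: lt_nbhsl.
  have := @derive_val _ _ _ _ _ _ _ (is_derive_trunc_L t (p ^+ 2) t0).
  rewrite (@derive_val _ _ _ _ _ _ _ d0) => /esym/eqP.
  rewrite paddr_eq0 ?mulr_ge0 ?expR_ge0// => /andP[+ _].
  by rewrite mulf_eq0 (gt_eqF (expR_gt0 _)) orbF horner_exp sqrf_eq0.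
(* The points [z/2], [z/3], ... are distinct and lie strictly between 0 and [z]; [size p] of them
   exceed the degree. *)
apply/eqP/(@roots_geq_poly_eq0 _ _ [seq z / i.+2%:R | i <- iota 0 (size p)]).
- apply/allP => _ /mapP[i _ ->]; apply: pr; rewrite divr_gt0//=.
  by rewrite ltr_pdivrMr// ltr_pMr// ltr1n.
- rewrite map_inj_uniq ?iota_uniq// => i j /(mulfI (lt0r_neq0 z0)).
  by move=> /invr_inj/eqP; rewrite eqr_nat => /eqP[].
- by rewrite size_map size_iota.
Unshelve. all: by end_near. Qed.

Lemma trunc_L0 {R : realType} (z : R) : trunc_L z 0 = 0.
Proof. by rewrite -(scale0r 0) trunc_LZ mul0r. Qed.

Lemma trunc_L_sum {R : realType} (z : R) n (F : 'I_n -> {poly R}) :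
  trunc_L z (\sum_i F i) = \sum_i trunc_L z (F i).
Proof. exact: (big_morph _ (trunc_LD z) (trunc_L0 z)). Qed.

Lemma trunc_LB {R : realType} (z : R) (p q : {poly R}) :
  trunc_L z (p - q) = trunc_L z p - trunc_L z q.
Proof. by rewrite -scaleN1r trunc_LD trunc_LZ mulN1r. Qed.

(** * Orthogonality, parity and recurrence at a fixed [z] *)

Section TruncatedHermite.
Context {R : realType} {P : R -> nat -> {poly R}} (hP : truncated_hermite P).
Context {z : R} (z0 : 0 < z).

Lemma size_hermite n : size (P z n) = n.+1.
Proof. by have [_ ->] := hP z z0. Qed.

Lemma coef_hermite n : (P z n)`_n = 1.
Proof.
have [/(_ n)/monicP + _ _] := hP z z0.
by rewrite lead_coefE size_hermite.
Qed.

Lemma hermite_orth k n : k != n -> trunc_L z (P z k * P z n) = 0.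
Proof. by have [_ _ ->] := hP z z0; case: eqP. Qed.

Lemma hermite_sqr n : trunc_L z (P z n * P z n) = sq_norm P n z.
Proof. by rewrite -expr2. Qed.

Lemma sq_norm_gt0 n : 0 < sq_norm P n z.
Proof.
by rewrite /sq_norm trunc_L_sqr_gt0// -size_poly_gt0 size_hermite.
Qed.

Lemma size_sub_coef_hermite n (q : {poly R}) : (size q <= n.+1)%N ->
  (size (q - q`_n *: P z n)%R <= n)%N.
Proof.
move=> sq; apply/leq_sizeP => j.
rewrite leq_eqVlt coefB coefZ => /predU1P[<-|nj].
  by rewrite coef_hermite mulr1 subrr.
rewrite [q`_j]nth_default ?(leq_trans sq)// [(P z n)`_j]nth_default.
  by rewrite mulr0 subrr.
by rewrite size_hermite.
Qed.

(** Induction on [n]: subtracting the right multiple of the monic [P z n] removes the top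
    coefficient of [r]. *)
Lemma hermite_span n (q : {poly R}) :
  (forall k, (k < n)%N -> trunc_L z (P z k * q) = 0) ->
  forall r : {poly R}, (size r <= n)%N -> trunc_L z (r * q) = 0.
Proof.
elim: n => [|n IH] Pq r sr.
  move: sr; rewrite leqn0 size_poly_eq0 => /eqP->.
  by rewrite mul0r trunc_L0.
rewrite -(subrK (r`_n *: P z n) r) mulrDl trunc_LD -scalerAl trunc_LZ.
rewrite Pq// mulr0 addr0 IH ?size_sub_coef_hermite// => k kn.
by rewrite Pq// ltnW.
Qed.

Lemma hermite_orth_low n (r : {poly R}) : (size r <= n)%N ->
  trunc_L z (r * P z n) = 0.
Proof.
by apply: hermite_span => k kn; rewrite hermite_orth// ltn_eqF.
Qed.

Lemma trunc_L_coef n (r : {poly R}) : (size r <= n.+1)%N ->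
  trunc_L z (r * P z n) = r`_n * sq_norm P n z.
Proof.
move=> sr; rewrite -{1}(subrK (r`_n *: P z n) r) mulrDl trunc_LD.
by rewrite hermite_orth_low ?size_sub_coef_hermite// add0r -scalerAl trunc_LZ
  hermite_sqr.
Qed.

(** The difference [q - P z n] has degree below [n], so it is orthogonal to both [q] and [P z n],
    hence to itself; positivity makes it 0. Parity and the recurrence both follow from this
    characterization. *)
Lemma hermite_unique n (q : {poly R}) : (size q <= n.+1)%N -> q`_n = 1 ->
  (forall k, (k < n)%N -> trunc_L z (P z k * q) = 0) -> q = P z n.
Proof.
move=> sq qn Pq; apply/eqP; rewrite -subr_eq0.
have sd : (size (q - P z n)%R <= n)%N.
  by have := size_sub_coef_hermite _ _ sq; rewrite qn scale1r.
apply: contraT => /(trunc_L_sqr_gt0 _ _ z0).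
by rewrite expr2 mulrBr trunc_LB hermite_orth_low// (hermite_span _ _ Pq)//
  subr0 ltxx.
Qed.

Lemma hermite_parity n : P z n \Po - 'X = (-1) ^+ n *: P z n.
Proof.
have s1 : (-1) ^+ n * (-1) ^+ n = 1 :> R by rewrite -expr2 sqrr_sign.
suff E : (-1) ^+ n *: (P z n \Po - 'X) = P z n by rewrite -{2}E scalerA s1 scale1r.
have sN (r : {poly R}) : size (r \Po - 'X) = size r.
  by rewrite size_comp_poly2// size_polyN size_polyX.
apply: hermite_unique.
- by rewrite (leq_trans (size_scale_leq _ _))// sN size_hermite.
- rewrite coefZ.
  have -> : P z n \Po - 'X = \poly_(i < n.+1) ((-1) ^+ i * (P z n)`_i).
    rewrite comp_polyE size_hermite poly_def; apply: eq_bigr => i _.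
    rewrite (exprNn 'X) -signr_odd -[in RHS]signr_odd; case: (odd i).
      by rewrite !expr1 !mulN1r scalerN scaleNr.
    by rewrite !expr0 !mul1r.
  by rewrite coef_poly ltnS leqnn coef_hermite mulr1.
- move=> k kn; rewrite -scalerAr trunc_LZ.
  (* Writing [P z k] as a double reflection lets the invariance of the functional move the
     reflection from [P z n] to [P z k]. *)
  have -> : P z k = (P z k \Po - 'X) \Po - 'X.
    by rewrite -comp_polyA rmorphN /= comp_polyX opprK comp_polyXr.
  rewrite -rmorphM /= trunc_L_reflect ?ltW//.
  by rewrite hermite_orth_low ?mulr0// sN size_hermite.
Qed.

(** By parity the polynomial is odd. This is why the recurrence has no diagonal term. *)
Lemma trunc_L_X_sqr n : trunc_L z ('X * P z n * P z n) = 0.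
Proof.
have := trunc_L_reflect z ('X * P z n * P z n) (ltW z0).
rewrite !rmorphM /= comp_polyX !hermite_parity -!scalerAr -!scalerAl.
rewrite scalerA -expr2 sqrr_sign scale1r !mulNr -scaleN1r trunc_LZ; lra.
Qed.

(** The right-hand side is monic of degree [n.+1]. It is orthogonal to [P z k] by oddness for
    [k = n], by the choice of [rec_coef] for [k = n.-1], and by the degree of ['X * P z k] below
    that. At [n = 0] the coefficient is 0, so the default [n.-1 = 0] is harmless. *)
Lemma hermite_rec n :
  P z n.+1 = 'X * P z n - rec_coef P n z *: P z n.-1.
Proof.
have sX k : (size ('X * P z k)%R <= k.+2)%N.
  by rewrite (leq_trans (size_polyMleq _ _))// size_polyX size_hermite.
apply/esym/hermite_unique.
- rewrite (leq_trans (size_polyD _ _))// geq_max sX size_polyN.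
  rewrite (leq_trans (size_scale_leq _ _))// size_hermite.
  by case: n => //= n; rewrite ltnS ltnW.
- rewrite coefB coefXM coefZ /= coef_hermite [X in _ * X]nth_default.
    by rewrite mulr0 subr0.
  by rewrite size_hermite; case: n.
move=> k; rewrite ltnS leq_eqVlt => /predU1P[->{k}|].
  rewrite mulrBr trunc_LB mulrCA mulrA trunc_L_X_sqr -scalerAr trunc_LZ sub0r.
  case: n => [|n] /=; first by rewrite mul0r oppr0.
  by rewrite hermite_orth ?mulr0 ?oppr0// gtn_eqF.
case: n => // n; rewrite ltnS => kn /=.
rewrite mulrBr trunc_LB mulrCA mulrA -scalerAr trunc_LZ.
rewrite trunc_L_coef; last by rewrite (leq_trans (sX k)).
rewrite coefXM /=; move: kn; rewrite leq_eqVlt => /predU1P[->|kn].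
  rewrite coef_hermite hermite_sqr mul1r divfK ?subrr//.
  by rewrite gt_eqF// sq_norm_gt0.
by rewrite nth_default ?size_hermite// mul0r hermite_orth ?ltn_eqF// mulr0 subr0.
Qed.

(** Expanding by the recurrence, the cross term vanishes and [h_(n+1) + gamma_n^2 h_(n-1)] remains,
    where [h_(n+1) = gamma_(n+1) h_n] and [gamma_n h_(n-1) = h_n] for [n >= 1]. *)
Lemma trunc_L_XX_sqr n :
  trunc_L z (('X * P z n) ^+ 2) =
  (rec_coef P n.+1 z + rec_coef P n z) * sq_norm P n z.
Proof.
have h0 := sq_norm_gt0.
have := hermite_rec n => /esym/eqP; rewrite subr_eq => /eqP->.
rewrite sqrrD mulr2n !trunc_LD !expr2 -!scalerAr -!scalerAl.
rewrite !trunc_LZ !hermite_sqr hermite_orth; last first.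
  by case: n => //= n; rewrite gtn_eqF// ltnW.
rewrite mulr0 !addr0 mulrDl divfK ?gt_eqF//; congr (_ + _).
by case: n => [|n] /=; rewrite ?mul0r// divfK// gt_eqF.
Qed.

Lemma sq_norm_derive_identity n :
  z * (gaussian_mul (P z n ^+ 2) z + gaussian_mul (P z n ^+ 2) (- z)) =
  (2 * n%:R + 1 - 2 * (rec_coef P n.+1 z + rec_coef P n z)) * sq_norm P n z.
Proof.
(* The odd factor ['X] turns the sum of boundary values into the difference that [trunc_L_ibp]
   produces. *)
transitivity ((('X * P z n ^+ 2).[z] - ('X * P z n ^+ 2).[- z]) *
    expR (- z ^+ 2)).
  by rewrite /gaussian_mul !hornerM !hornerX sqrrN; ring.
rewrite -trunc_L_ibp//.
have -> : ('X * P z n ^+ 2)^`() - 2 *: ('X * ('X * P z n ^+ 2)) =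
    P z n * P z n + 2 *: (('X * (P z n)^`()) * P z n)
    - 2 *: (('X * P z n) ^+ 2).
  by rewrite expr2 !derivM derivX -!mul_polyC; ring.
rewrite trunc_LB trunc_LD !trunc_LZ trunc_L_XX_sqr hermite_sqr trunc_L_coef.
  rewrite coefXM; case: n => [|n] /=; first by ring.
  by rewrite coef_deriv coef_hermite; ring.
apply/leq_sizeP => -[//|j] nj; rewrite coefXM coef_deriv nth_default ?mul0rn//.
by rewrite size_hermite.
Qed.

End TruncatedHermite.

(** * Differentiability in [z] of the norms and coefficients *)

(* Near [z], [h_n(t) = L_t[P_n(t) P_n(z)] = \sum_i a_i(t) L_t[x^i P_n(z)], with
   [a_i(t)] the coefficients of [P_n(t)].  At [t = z] the terms with [a_i']
   vanish: [L_z[x^i P_n(z)] = 0] for [i < n], and [a_n = 1] is constant. *)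
Lemma is_derive_sq_norm {R : realType} {P : R -> nat -> {poly R}}
    (hP : truncated_hermite P) (n : nat) (z : R) : 0 < z ->
  (forall i, derivable (fun t => (P t n)`_i) z 1) ->
  is_derive z 1 (sq_norm P n)
    (gaussian_mul (P z n ^+ 2) z + gaussian_mul (P z n ^+ 2) (- z)).
Proof.
move=> z0 dP.
pose F (i : 'I_n.+1) (t : R) : R := trunc_L t ('X^i * P z n).
pose G (i : 'I_n.+1) (t : R) : R := (P t n)`_i.
pose dF (i : 'I_n.+1) : R :=
  gaussian_mul ('X^i * P z n) z + gaussian_mul ('X^i * P z n) (- z).
apply: (@near_eq_is_derive _ _ _ (\sum_(i < n.+1) (G i * F i))).
  near=> t; have t0 : 0 < t by near: t; exact: lt_nbhsr.
  (* Since [P z n] is also monic of degree [n], it may replace one factor [P t n] in the norm at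
     [t]. *)
  have := trunc_L_coef hP t0 n (P z n).
  rewrite (size_hermite hP z0) (coef_hermite hP z0) mul1r => <-//.
  rewrite fct_sumE mulrC -[in RHS](coefK (P t n)) (size_hermite hP t0) poly_def.
  rewrite mulr_suml trunc_L_sum; apply: eq_bigr => i _.
  by rewrite -scalerAl trunc_LZ.
have dGF i : is_derive z 1 (G i * F i) (G i z * dF i).
  have dG : is_derive z 1 (G i) ('D_1 (G i) z) by apply: derivableP; exact: dP.
  have dFi : is_derive z 1 (F i) (dF i) by exact: is_derive_trunc_L.
  apply: (is_derive_eq (is_deriveM dG dFi)).
  suff -> : F i z *: 'D_1 (G i) z = 0 by rewrite addr0.
  have [->|ni] := eqVneq i ord_max; last first.
    rewrite /F (hermite_orth_low hP z0) ?scale0r// size_polyXn.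
    by rewrite ltn_neqAle -ltnS ltn_ord andbT.
  suff -> : 'D_1 (G ord_max) z = 0 by rewrite scaler0.
  rewrite (@near_eq_derive R R R _ (cst 1)) ?derive_cst//.
  near=> t; have t0 : 0 < t by near: t; exact: lt_nbhsr.
  exact: coef_hermite.
apply: (is_derive_eq (is_derive_sum dGF)).
have gsum x : gaussian_mul (P z n ^+ 2) x =
    \sum_(i < n.+1) (P z n)`_i * gaussian_mul ('X^i * P z n) x.
  rewrite /gaussian_mul expr2 hornerM [in X in X * _ * _]horner_coef.
  rewrite (size_hermite hP z0) !mulr_suml; apply: eq_bigr => i _.
  by rewrite hornerM hornerXn !mulrA.
rewrite !gsum -big_split; apply: eq_bigr => i _.
by rewrite /= mulrDr.
Unshelve. all: by end_near. Qed.

(* The recurrence expresses [P_(n+1)] through norms of smaller index, which are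
   differentiable by [is_derive_sq_norm] and the induction hypothesis. *)
Lemma derivable_coef_hermite {R : realType} {P : R -> nat -> {poly R}}
    (hP : truncated_hermite P) (n : nat) (z : R) (i : nat) : 0 < z ->
  derivable (fun t => (P t n)`_i) z 1.
Proof.
elim/ltn_ind: n z i => -[|n] IH z i z0.
  (* For [t > 0], where [P] is constrained, [P t 0] is the constant 1. *)
  apply: (@near_eq_derivable R R R (cst (i == 0)%:R)); last exact: derivable_cst.
  near=> t; have t0 : 0 < t by near: t; exact: lt_nbhsr.
  case: i => [|i]; first by rewrite (coef_hermite hP t0).
  by rewrite nth_default// (size_hermite hP t0).
pose f (t : R) : R := ('X * P t n)`_i.
pose g (t : R) : R := (P t n.-1)`_i.
apply: (@near_eq_derivable _ _ _ (f - rec_coef P n * g)).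
  near=> t; have t0 : 0 < t by near: t; exact: lt_nbhsr.
  by rewrite (hermite_rec hP t0) coefB coefZ.
have dsq k : (k <= n)%N -> derivable (sq_norm P k) z 1.
  move=> kn; apply: ex_derive; apply: is_derive_sq_norm => // j.
  exact: IH.
apply: derivableB.
  case: i @f {g} => [|i] f.
    apply: (@near_eq_derivable R R R (cst 0)); last exact: derivable_cst.
    by near=> t; rewrite /f coefXM.
  apply: (@near_eq_derivable _ _ _ (fun t => (P t n)`_i)); last exact: IH.
  by near=> t; rewrite /f coefXM.
(* For [P t 1] the subtracted term is 0, as [rec_coef P 0] vanishes; otherwise it involves a
   quotient of two earlier norms. *)
case: n @f IH @g dsq => [|n] f IH g dsq /=.
  apply: (@near_eq_derivable R R R (cst 0)); last exact: derivable_cst.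
  by near=> t; rewrite /= fctE mul0r.
apply: derivableM; last exact: IH.
apply: derivableM; first exact: dsq.
apply: derivableV; last exact: dsq.
by rewrite gt_eqF// (sq_norm_gt0 hP).
Unshelve. all: by end_near. Qed.

(** This is [sq_norm_derive_identity] divided by [z h_n]; the factor [z^-1] stays in front for
    [theta] to cancel. *)
Lemma is_derive_ln_sq_norm {R : realType} {P : R -> nat -> {poly R}}
    (hP : truncated_hermite P) (n : nat) (z : R) : 0 < z ->
  is_derive z 1 (fun t => ln (sq_norm P n t))
    (z^-1 * (2 * n%:R + 1 - 2 * (rec_coef P n.+1 z + rec_coef P n z))).
Proof.
move=> z0; have h0 := sq_norm_gt0 hP z0 n.
have dh := is_derive_sq_norm hP n z z0
  (fun i => derivable_coef_hermite hP n z i z0).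
apply: (is_derive_eq (is_derive1_comp (is_derive1_ln h0) dh)).
apply: (mulfI (lt0r_neq0 z0)); rewrite mulVKf ?gt_eqF//.
by rewrite mulrCA (sq_norm_derive_identity hP z0) mulrC mulfK// gt_eqF.
Qed.

Theorem theorem24 (R : realType) (P : R -> nat -> {poly R})
    (hP : truncated_hermite P) (z : R) (hz : 0 < z) :
  (forall n : nat,
     derivable (fun t : R => ln (sq_norm P n t)) z 1 /\
     theta (fun t : R => ln (sq_norm P n t)) z =
       2 * n%:R + 1 - 2 * (rec_coef P n.+1 z + rec_coef P n z)) /\
  (forall n : nat, (1 <= n)%N ->
     derivable (fun t : R => ln (rec_coef P n t)) z 1 /\
     theta (fun t : R => ln (rec_coef P n t)) z =
       2 * (rec_coef P n.-1 z - rec_coef P n.+1 z + 1)).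
Proof.
have isd (f : R -> R) d : is_derive z 1 f (z^-1 * d) ->
    derivable f z 1 /\ theta f z = d.
  case=> df fd; split=> //.
  by rewrite /theta derive1E fd mulVKf ?gt_eqF.
split=> [n | [//|n] _]; apply: isd; first exact: is_derive_ln_sq_norm.
have dh k := is_derive_ln_sq_norm hP k z hz.
(* Near [z] both norms are positive, so the logarithm of their quotient splits. *)
apply: (@near_eq_is_derive _ _ _
  ((fun t => ln (sq_norm P n.+1 t)) - (fun t => ln (sq_norm P n t)))).
  near=> t; have t0 : 0 < t by near: t; exact: lt_nbhsr.
  by rewrite /= ln_div// posrE (sq_norm_gt0 hP).
apply: (is_derive_eq (is_deriveB (dh n.+1) (dh n))).
(* With the index shifted to [n.+1], the two copies of [gamma_(n+1)] cancel and the constants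
   [2 (n + 1) + 1] and [2 n + 1] differ by 2. *)
by rewrite -mulrBr; congr (_ * _); rewrite -natr1 /=; ring.
Unshelve. all: by end_near. Qed.
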